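(* There exists an absolute constant $C>0$ such that for all integers $r\ge 3$ and $w\ge 2$, every $w$-set system $\mathcal F$ of size $|\mathcal F|\ge (C r^3\,\log w\,\log\log w)^w$ contains an $r$-sunflower.
   Context: A set system on a finite set $X$ is a collection of (distinct) subsets of $X$. It is a $w$-set system if each of its sets has size at most $w$. A collection of $r$ distinct sets $S_1,\dots,S_r$ is an $r$-sunflower if $S_i\cap S_j=S_1\cap\cdots\cap S_r$ for all $i\neq j$. A set system contains an $r$-sunflower if some $r$ distinct members of it form one. Convention: $\log$ denotes the logarithm in base $1.9$, so that $\log\log w>0$ for every $w\ge 2$. *)

(* Defs.v *)
From HB Require Import structures.
From mathcomp Require Import all_boot all_order all_algebra.
From mathcomp Require Import reals exp.

Set Implicit Arguments.
Unset Strict Implicit.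
Unset Printing Implicit Defensive.

Import Order.TTheory GRing.Theory Num.Theory.

Definition set_system_width (T : finType) (w : nat) (F : {set {set T}}) : Prop :=
  forall A : {set T}, A \in F -> #|A| <= w.

Definition sunflower (T : finType) (r : nat) (S : {set {set T}}) : Prop :=
  #|S| = r /\
  forall A B : {set T}, A \in S -> B \in S -> A != B ->
    A :&: B = \bigcap_(D in S) D.

Definition contains_sunflower (T : finType) (r : nat) (F : {set {set T}}) : Prop :=
  exists2 S : {set {set T}}, S \subset F & sunflower r S.

Local Open Scope ring_scope.

(* Base 1.9 < 2, so that log19 (log19 w) > 0 for every integer w >= 2. *)
Definition log19 (R : realType) (x : R) : R := ln x / ln (19 / 10).

(* Main.v *)
Require Import Defs.
From HB Require Import structures.
From mathcomp Require Import all_boot all_order all_algebra.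
From mathcomp Require Import reals exp.
From mathcomp Require Import zify ring lra.

Set Implicit Arguments.
Unset Strict Implicit.
Unset Printing Implicit Defensive.

Import Order.TTheory GRing.Theory Num.Theory.
Local Open Scope nat_scope.

(** The proof gives the stronger bound (8 r^2 L)^w, where 2^(L-1) <= w < 2^L:
    the slack left by r^3 and by log log w, which is bounded away from 0 for
    w >= 2, is absorbed by the constant.

    Call a family F kappa-spread when at most |F| / kappa^|Z| of its members
    contain Z, for every Z.  A family with more than (2 kappa)^w members has a
    uniform layer of some size k with more than kappa^k members
    ([large_layer]); choosing Z to maximise kappa^|Z| times the number of
    members above Z makes the link of the layer at Z spread, without empty set
    ([uniform_spread_link]).  Pairwise disjoint members of the link become the
    petals of a sunflower with kernel Z ([sunflower_of_link]).

    It remains to find r disjoint members of a spread family F with sets of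
    size at most w ([spread_disjoint_members]).  Colour the ground set
    uniformly at random with N = r L colours, in r groups of L, where
    kappa = 4 r N.  It suffices that each group fails to cover a member of F
    with probability less than 1/r: then some colouring has all groups
    succeed, and the covered members are disjoint.

    The colours of a group are revealed one at a time.  Every member A of F
    carries a residual set phi(A), a subset of A which, together with the
    region revealed so far, covers some member of F; at first phi(A) = A.  When
    the class W of a new colour is revealed, phi(A) is replaced by its
    fragment: the smallest set of the form phi(B) \ W with phi(B) contained in
    phi(A) and W together.  If this does not bring the size from w down to
    half of w, then A is discarded.  A discarded pair (colouring, A) is
    encoded cheaply: repaint the fragment S with the new colour.  The new
    colouring, by minimality, determines a set of size at most w that contains
    S ([fragment_sub_covered]), so there are at most 2^w choices for S; then
    N^|S| choices for the old colours on S, and at most |F| / kappa^|S| choices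
    for A, which contains S.  As |S| > w/2, the factor (N / kappa)^|S| =
    (4 r)^-|S| outweighs 2^w ([card_lost_pairs]).  A round that halves the width
    to h (rounded down) thus discards at most a fraction 2^-(h+1) / r of the
    pairs ([card_lost_pairs_bound]); the values of h are distinct, so the total
    loss stays below 1/r, whatever the number of rounds
    ([card_failures_stage]).  After L rounds the residual sets
    are empty, so a group fails only for colourings where every A has been
    discarded. *)

(** * Spread families and fragments *)

Definition spread (T : finType) (kappa : nat) (F : {set {set T}}) : Prop :=
  forall Z : {set T}, #|[set A in F | Z \subset A]| * kappa ^ #|Z| <= #|F|.

Lemma card_dep_pairs (A B : finType) (P : pred A) (Q : A -> {set B}) :
  #|[set u : A * B | P u.1 && (u.2 \in Q u.1)]| = \sum_(a | P a) #|Q a|.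
Proof.
rewrite -sum1dep_card -(pair_big_dep P (fun a b => b \in Q a) (fun _ _ => 1)) /=.
by apply: eq_bigr => a _; rewrite sum1_card.
Qed.

Section Fragments.
Variables (T I : finType) (G : {set I}) (phi : I -> {set T}) (W : {set T}).

(** [fragment] minimises over the whole family, not over [A] alone; this is what
    makes it a subset of every member of the family covered by [W] and it. *)
Definition fragment_source (A : I) : I :=
  [arg min_(B < A | (B \in G) && (phi B \subset phi A :|: W)) #|phi B :\: W|].

Definition fragment (A : I) : {set T} := phi (fragment_source A) :\: W.

Lemma fragment_sourceP A : A \in G ->
  [/\ fragment_source A \in G, phi (fragment_source A) \subset phi A :|: W
    & forall B, B \in G -> phi B \subset phi A :|: W ->
        #|fragment A| <= #|phi B :\: W|].
Proof.
move=> AG; rewrite /fragment /fragment_source.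
case: arg_minnP => [|B /andP[BG sB] minB]; first by rewrite AG subsetUl.
by split=> // D DG sD; apply: minB; rewrite DG.
Qed.

Lemma fragment_sub A : A \in G -> fragment A \subset phi A.
Proof. by case/fragment_sourceP=> _ sB _; rewrite subDset setUC. Qed.

(** Such a [B] competes with the source of the fragment of [A], and what it
    leaves outside [W] lies in the fragment, so by minimality the two agree. *)
Lemma fragment_minimal A B :
  A \in G -> B \in G -> phi B \subset W :|: fragment A -> fragment A \subset phi B.
Proof.
move=> AG BG sB; have [_ _ minA] := fragment_sourceP AG.
have sBA : phi B :\: W \subset fragment A by rewrite subDset.
have /eqP <- : phi B :\: W == fragment A.
  rewrite eqEcard sBA minA //; apply: subset_trans sB _.
  by rewrite setUC setSU // fragment_sub.
exact: subsetDl.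
Qed.

End Fragments.

(** * Revealing the colours of a group one at a time *)

Section Rounds.
Variables (T K : finType) (F : {set {set T}}) (r : nat).
Hypothesis r_gt1 : 1 < r.
Hypothesis spreadF : spread (4 * r * #|K|) F.

Local Notation coloring := {ffun T -> K}.

Definition cell (c : coloring) (k : K) : {set T} := [set x | c x == k].
Definition region (c : coloring) (P : {set K}) : {set T} := [set x | c x \in P].

(** The situation after the colours in [P] have been revealed: [G c] are the
    members of [F] not yet discarded and [phi c] gives their residual sets.
    [stage_origin] says at once that a residual set avoids the revealed region
    and that it completes this region to a superset of a member of [F].
    [stage_local] says that the unrevealed colours have had no influence, so
    that they may be changed freely. *)
Record stage (P : {set K}) (w : nat) (G : coloring -> {set {set T}})
    (phi : coloring -> {ffun {set T} -> {set T}}) : Prop := Stage {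
  stage_members : forall c, G c \subset F;
  stage_width : forall c A, A \in G c -> #|phi c A| <= w;
  stage_sub : forall c A, A \in G c -> phi c A \subset A;
  stage_origin : forall c A, A \in G c ->
    exists2 D, D \in F & phi c A = D :\: region c P;
  stage_local : forall c c', {in P, cell c =1 cell c'} ->
    G c = G c' /\ phi c = phi c' }.

Definition recolor (c : coloring) (S : {set T}) (a : K) : coloring :=
  [ffun x => if x \in S then a else c x].

Definition agree_off (c : coloring) (S : {set T}) : {set coloring} :=
  [set d : coloring | [forall (x | x \notin S), d x == c x]].

Lemma card_agree_off (c : coloring) (S : {set T}) :
  #|agree_off c S| = #|K| ^ #|S|.
Proof.
rewrite cardsE.
rewrite (eq_card (B := family (fun x => if x \in S then predT else pred1 (c x)))).
  rewrite card_family foldrE big_map big_enum /= (bigID (mem S)) /=.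
  rewrite (eq_bigr (fun=> #|K|)) => [|x ->]; last by [].
  rewrite prod_nat_const big1 ?muln1 // => x /negPf->; exact: card1.
move=> d; apply/forall_inP/familyP => [dP x|dP x xS].
  by case: ifPn => // /dP; rewrite inE.
by move: (dP x); rewrite (negPf xS) inE.
Qed.

Section OneRound.
Variables (P : {set K}) (a : K) (w : nat).
Variables (G : coloring -> {set {set T}}).
Variable phi : coloring -> {ffun {set T} -> {set T}}.
Hypotheses (stG : stage P w G phi) (aP : a \notin P).

Definition round_phi (c : coloring) : {ffun {set T} -> {set T}} :=
  [ffun A => fragment (G c) (phi c) (cell c a) A].

Definition round_G (c : coloring) : {set {set T}} :=
  [set A in G c | #|round_phi c A| <= w./2].

Definition lost_pairs : {set coloring * {set T}} :=
  [set u | (u.2 \in G u.1) && (w./2 < #|round_phi u.1 u.2|)].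

Lemma region_setU1 c : region c (a |: P) = cell c a :|: region c P.
Proof. by apply/setP=> x; rewrite !inE. Qed.

Lemma round_stage : stage (a |: P) w./2 round_G round_phi.
Proof.
split=> [c|c A|c A|c A|c c' eqc].
- by apply: subset_trans (stage_members stG c); apply/subsetP=> A; rewrite inE => /andP[].
- by rewrite inE => /andP[].
- rewrite inE => /andP[AG _]; rewrite ffunE.
  exact: subset_trans (fragment_sub _ _ AG) (stage_sub stG AG).
- rewrite inE => /andP[AG _]; rewrite ffunE /fragment.
  have [BG _ _] := fragment_sourceP (phi c) (cell c a) AG.
  have [D DF ->] := stage_origin stG BG.
  by exists D => //; rewrite region_setU1 setDDl setUC.
- have [eG ephi] : G c = G c' /\ phi c = phi c'.
    by apply: (stage_local stG) => k kP; apply: eqc; rewrite inE kP orbT.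
  have ea : cell c a = cell c' a by apply: eqc; rewrite setU11.
  have e : round_phi c = round_phi c' by rewrite /round_phi eG ephi ea.
  by split; rewrite // /round_G e eG.
Qed.

(** The decoder: a set that is read off from the repainted colouring alone and
    contains the fragment that was repainted. *)
Definition covered_set (c : coloring) : {set T} :=
  if [pick B in G c | phi c B \subset cell c a] is Some B then phi c B else set0.

Lemma card_covered_set c : #|covered_set c| <= w.
Proof.
rewrite /covered_set; case: pickP => [B /andP[BG _]|_]; last by rewrite cards0.
exact: (stage_width stG BG).
Qed.

(** The fragment avoids the cells of [P], so that repainting it with [a] changes
    neither [G] nor [phi], and only adds it to the cell of [a]. The source of
    the fragment then lies in the new cell, so the decoder finds some residual
    set there, and [fragment_minimal] applies to it. *)
Lemma fragment_sub_covered c A : A \in G c ->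
  round_phi c A \subset covered_set (recolor c (round_phi c A) a).
Proof.
move=> AG; set S := round_phi c A; set c' := recolor c S a.
have SE : S = fragment (G c) (phi c) (cell c a) A by rewrite /S ffunE.
have [BG _ _] := fragment_sourceP (phi c) (cell c a) AG.
have cellE : cell c' a = cell c a :|: S.
  by apply/setP=> x; rewrite !inE ffunE orbC; case: ifP; rewrite ?eqxx.
have S_notP x : x \in S -> c x \notin P.
  rewrite SE inE => /andP[_]; have [D _ ->] := stage_origin stG BG.
  by rewrite !inE => /andP[].
have [eG ephi] : G c' = G c /\ phi c' = phi c.
  apply: (stage_local stG) => k kP; apply/setP=> x; rewrite !inE ffunE.
  case: ifP => // /S_notP cxP; apply/eqP/eqP => [ak|ck].
    by move: aP; rewrite ak kP.
  by move: cxP; rewrite ck kP.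
rewrite /covered_set eG ephi cellE; case: pickP => [B /andP[BG' sB]|none].
  by rewrite SE; apply: fragment_minimal => //; rewrite -SE.
have := none (fragment_source (G c) (phi c) (cell c a) A).
by rewrite /= BG SE -subDset subxx.
Qed.

(** Multiplicity count of the encoding of a lost pair [(c, A)] by the repainted
    colouring, the fragment, the colouring [c] and [A]. For a fragment [S], the
    spread factor (4 r N)^|S| pays for the N^|S| colourings [c] and leaves
    (4 r)^|S|, which is at least the factor on the left. *)
Lemma card_lost_pairs :
  #|lost_pairs| * (4 * r) ^ w./2.+1 <= #|K| ^ #|T| * 2 ^ w * #|F|.
Proof.
pose ok (v : coloring * {set T}) := (v.2 \subset covered_set v.1) && (w./2 < #|v.2|).
pose preimages (v : coloring * {set T}) :=
  setX (agree_off v.1 v.2) [set A in F | v.2 \subset A].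
(* Pairs consisting of an encoding (colouring, fragment) and a lost pair that
   may have produced it; a lost pair is its own second component. *)
pose codes := [set u | ok u.1 && (u.2 \in preimages u.1)].
pose code (u : coloring * {set T}) :=
  ((recolor u.1 (round_phi u.1 u.2) a, round_phi u.1 u.2), u).
have le_codes : #|lost_pairs| <= #|codes|.
  rewrite -(card_in_imset (f := code)); last by move=> u v _ _ [].
  apply/subset_leq_card/subsetP => _ /imsetP[[c A] + ->].
  rewrite inE /= => /andP[AG big].
  have sSA : round_phi c A \subset A.
    by rewrite ffunE; apply: subset_trans (fragment_sub _ _ AG) (stage_sub stG AG).
  rewrite !inE /= /ok big fragment_sub_covered // sSA (subsetP (stage_members stG c)) //=.
  rewrite andbT; apply/forall_inP => x /negPf xS.
  by rewrite [X in _ == X]ffunE xS.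
apply: (leq_trans (leq_mul le_codes (leqnn _))).
rewrite card_dep_pairs; under eq_bigr do rewrite cardsX card_agree_off.
rewrite big_distrl /=.
pose candidates := [set v : coloring * {set T} | predT v.1 &
  v.2 \in powerset (covered_set v.1)].
apply: (@leq_trans (\sum_(v in candidates) #|F|)).
  rewrite [leqRHS](bigID (fun v : coloring * {set T} => w./2 < #|v.2|)) /=.
  rewrite [X in _ <= X + _](eq_bigl ok) => [|v]; last by rewrite !inE.
  apply: leq_trans (leq_addr _ _); apply: leq_sum => v /andP[_ big].
  apply: leq_trans (spreadF v.2); rewrite mulnAC mulnC leq_mul2l; apply/orP; right.
  rewrite [leqRHS]expnMn [leqRHS]mulnC leq_mul2l leq_pexp2l ?orbT //; lia.
rewrite sum_nat_const leq_mul2r; apply/orP; right.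
rewrite [leqLHS](card_dep_pairs predT (fun c => powerset (covered_set c))).
rewrite -card_ffun -sum_nat_const; apply: leq_sum => c _.
by rewrite card_powerset leq_pexp2l // card_covered_set.
Qed.

End OneRound.

(** As [w <= 2 h + 1] for [h] half of [w], the factor 4^(h+1) exceeds 2^w by a
    factor 2, and r^(h+1) is at least r 2^h. *)
Lemma card_lost_pairs_bound P a w G phi : stage P w G phi -> a \notin P ->
  r * 2 ^ w./2.+1 * #|lost_pairs a w G phi| <= #|K| ^ #|T| * #|F|.
Proof.
move=> stG aP; have := card_lost_pairs stG aP.
set b := #|_|; set h := w./2; set X := _ ^ #|T|; set M := #|F| => le_b.
have {le_b} : (b * (2 * r ^ h.+1)) * 2 ^ (2 * h + 1) <= (X * M) * 2 ^ (2 * h + 1).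
  have le_w : 2 ^ w <= 2 ^ (2 * h + 1) by rewrite leq_pexp2l //; lia.
  have e4 : (4 * r) ^ h.+1 = 2 ^ (2 * h + 1) * (2 * r ^ h.+1).
    by rewrite expnMn -[4]/(2 ^ 2) -expnM mulnA -expnSr; congr (2 ^ _ * _); lia.
  by move: le_b; rewrite e4; nia.
rewrite leq_pmul2r ?expn_gt0 //; apply: leq_trans.
rewrite mulnC leq_mul2l; apply/orP; right.
rewrite [r ^ _]expnS [2 ^ _]expnS mulnCA !leq_mul2l.
have -> : 2 ^ h <= r ^ h by case: (h) => // n; rewrite leq_exp2r.
by rewrite !orbT.
Qed.

Definition failures (Q : {set K}) : {set coloring} :=
  [set c | [forall D in F, ~~ (D \subset region c Q)]].

Definition lost (G : coloring -> {set {set T}}) : nat := \sum_c #|F :\: G c|.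

Lemma lost_round a w G phi :
  lost (round_G a w G phi) <= lost G + #|lost_pairs a w G phi|.
Proof.
have -> : #|lost_pairs a w G phi| =
    \sum_c #|[set A in G c | w./2 < #|round_phi a G phi c A|]|.
  by rewrite -(card_dep_pairs predT); apply: eq_card => u; rewrite !inE.
rewrite -big_split /=; apply: leq_sum => c _; apply: leq_trans (leq_card_setU _ _).
apply/subset_leq_card/subsetP => A; rewrite !inE => /andP[+ ->].
by case: (A \in G c) => //=; rewrite ltnNge.
Qed.

(** Divided by r 2^w |F| and by the number of colourings, this says that
    the failure probability is at most the present loss plus
    (1 - 2^-w) / r. With [h] half of [w], a round costs at most 2^-(h+1) / r, and
    (1 - 2^-h) + 2^-(h+1) = 1 - 2^-(h+1) <= 1 - 2^-w, which is why this form of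
    the bound is inductive. At width 0 the residual sets are empty, so a failure
    means that all of [F] is lost. *)
Lemma card_failures_stage w (P Q : {set K}) G phi :
  stage P w G phi -> P \subset Q -> w < 2 ^ #|Q :\: P| ->
  r * 2 ^ w * (#|failures Q| * #|F|) + #|K| ^ #|T| * #|F|
    <= r * 2 ^ w * lost G + 2 ^ w * (#|K| ^ #|T| * #|F|).
Proof.
elim/ltn_ind: w P G phi => -[|w'] IH P G phi stG sPQ lt_w.
  rewrite muln1 mul1n leq_add2r leq_mul2l; apply/orP; right.
  rewrite -sum_nat_const /lost [leqRHS](bigID (mem (failures Q))) /=.
  apply: leq_trans (leq_addr _ _); apply: leq_sum => c.
  rewrite inE => /forall_inP failc; apply/subset_leq_card/subsetP => A AF.
  rewrite inE AF andbT; apply/negP => AG.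
  have := stage_width stG AG; have [D DF ->] := stage_origin stG AG.
  rewrite leqn0 cards_eq0 setD_eq0 => sD; move/negP: (failc D DF); apply.
  apply: subset_trans sD _; apply/subsetP => x; rewrite !inE; exact: (subsetP sPQ).
set w := w'.+1 in lt_w *; set h := w./2.
have h_lt : h < w by rewrite /h /w; lia.
have /card_gt0P[a] : 0 < #|Q :\: P| by case: #|_| lt_w.
rewrite inE => /andP[aP aQ].
have cardQ : #|Q :\: P| = #|Q :\: (a |: P)|.+1.
  by rewrite (cardsD1 a (Q :\: P)) inE aP aQ setDDl setUC.
have := IH h h_lt _ _ _ (round_stage a stG).
rewrite subUset sub1set aQ sPQ => /(_ isT) {}IH.
have lt_h : h < 2 ^ #|Q :\: (a |: P)| by move: lt_w; rewrite cardQ expnS /h; lia.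
move: (IH lt_h) (card_lost_pairs_bound stG aP) (lost_round a w G phi).
rewrite -/h; set b := #|lost_pairs _ _ _ _|; set l' := lost (round_G _ _ _ _).
set X := _ ^ #|T| * #|F|; set f := _ * #|F|; set l := lost G.
have -> : 2 ^ w = 2 ^ h * 2 ^ (w - h) by rewrite -expnD subnKC // ltnW.
have : 2 <= 2 ^ (w - h) by rewrite -{1}[2]expn1 leq_pexp2l // subn_gt0.
rewrite expnS; set e := 2 ^ (w - h); set p := 2 ^ h => e2 IHw le_b le_l.
have scaled_IH := leq_mul (leqnn e) IHw.
have scaled_l := leq_mul (leqnn (e * r * p)) le_l.
have scaled_b := leq_mul (leqnn e) le_b.
have scaled_e := leq_mul e2 (leqnn X).
clearbody X f l l' b e p; clear -scaled_IH scaled_l scaled_b scaled_e; nia.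
Qed.

Lemma card_failures w (Q : {set K}) :
  (forall A, A \in F -> #|A| <= w) -> w < 2 ^ #|Q| ->
  r * 2 ^ w * (#|failures Q| * #|F|) + #|K| ^ #|T| * #|F|
    <= 2 ^ w * (#|K| ^ #|T| * #|F|).
Proof.
move=> widthF lt_w.
have st0 : stage set0 w (fun=> F) (fun=> [ffun A => A]).
  split=> // [c A AF|c A AF|c A AF]; rewrite ffunE //; first exact: widthF.
  by exists A => //; apply/setP=> x; rewrite !inE.
have := card_failures_stage st0 (sub0set Q); rewrite setD0 => /(_ lt_w).
by rewrite /lost big1 ?muln0 // => c _; rewrite setDv cards0.
Qed.

End Rounds.

(** * Disjoint members of a spread family *)

(** Union bound over the [r] groups of colours [Q j], each of which fails for
    fewer than a fraction 1/r of the colourings. *)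
Lemma spread_disjoint_members (T : finType) (F : {set {set T}}) (r L w : nat) :
  1 < r -> 0 < L -> w < 2 ^ L -> spread (4 * r * (r * L)) F ->
  (forall A, A \in F -> #|A| <= w) -> 0 < #|F| ->
  exists2 B : 'I_r -> {set T}, forall j, B j \in F
    & forall i j, i != j -> [disjoint B i & B j].
Proof.
move=> r1 L0 ltw spF wF F0; pose K : finType := ('I_r * 'I_L)%type.
have cardK : #|K| = r * L by rewrite card_prod !card_ord.
have {}spF : spread (4 * r * #|K|) F by rewrite cardK.
pose Q j : {set K} := [set k | k.1 == j].
have cardQ j : #|Q j| = L.
  rewrite -[RHS](card_ord L) -(card_imset predT (f := pair j)); last by move=> ? ? [].
  apply: eq_card => -[i l]; rewrite inE /=; apply/eqP/imsetP => [->|[m _ [-> _]] //].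
  by exists l.
have few j : r * #|failures F (Q j)| < #|{ffun T -> K}|.
  have := @card_failures T K F r r1 spF w (Q j) wF; rewrite cardQ => /(_ ltw).
  have X0 : 0 < #|K| ^ #|T| by rewrite expn_gt0 cardK muln_gt0 L0 (ltnW r1).
  rewrite -card_ffun in X0 *; move: X0 F0; set X := #|{ffun _}|; set f := #|failures _ _|.
  have : 0 < 2 ^ w by rewrite expn_gt0.
  set p := 2 ^ w; set M := #|F| => p0 X0 M0 H.
  have H1 : 0 < X * M by rewrite muln_gt0 X0.
  rewrite -(ltn_pmul2l p0) -(ltn_pmul2r M0); lia.
have [c good] : exists c, forall j, c \notin failures F (Q j).
  suff /existsP[c /forallP good] :
      [exists c : {ffun T -> K}, [forall j : 'I_r, c \notin failures F (Q j)]].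
    by exists c.
  apply: contraT => /existsPn bad; set X := #|{ffun T -> K}| in few.
  have cover : X <= \sum_(j < r) #|failures F (Q j)|.
    under eq_bigr do rewrite -sum1_card big_mkcond.
    rewrite exchange_big /= /X -sum1_card; apply: leq_sum => c _.
    by have /forallPn[j] := bad c; rewrite negbK => cj; rewrite (bigD1 j) //= cj.
  have {cover} : r * X <= \sum_(j < r) X.-1.
    apply: leq_trans (leq_mul (leqnn r) cover) _; rewrite big_distrr /=.
    by apply: leq_sum => j _; rewrite -ltnS; apply: leq_trans (few j) (leqSpred X).
  have := few (Ordinal (ltnW r1)); rewrite sum_nat_const card_ord => fewX.
  by rewrite (leq_pmul2l (ltnW r1)); case: (X) fewX => //= n _; rewrite ltnn.
have pick j : exists A, (A \in F) && (A \subset region c (Q j)).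
  have := good j; rewrite inE => /forall_inPn[A AF]; rewrite negbK => sA.
  by exists A; rewrite AF.
exists (fun j => xchoose (pick j)) => [j|i j ij].
  by case/andP: (xchooseP (pick j)).
have /andP[_ si] := xchooseP (pick i); have /andP[_ sj] := xchooseP (pick j).
rewrite -setI_eq0; apply/eqP/setP => x; rewrite !inE; apply/negP => /andP[xi xj].
move/subsetP/(_ _ xi): si; move/subsetP/(_ _ xj): sj.
by rewrite !inE => /eqP ej /eqP ei; rewrite -ei -ej eqxx in ij.
Qed.

(** * From spread families to sunflowers *)

(** For [Z] of maximal weight, comparing [Z] with [Z :|: Y] is exactly the spread
    condition for the link at [Y]. Uniformity keeps the empty set out of the
    link: if [Z] were a member, it would be the only member above itself and
    have weight kappa^k, less than the weight of the empty set. *)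
Lemma uniform_spread_link (T : finType) (F : {set {set T}}) (kappa k : nat) :
  (forall A, A \in F -> #|A| = k) -> 0 < kappa -> kappa ^ k < #|F| ->
  exists Z : {set T}, let F' := [set A :\: Z | A in [set A in F | Z \subset A]] in
    [/\ spread kappa F', set0 \notin F' & 0 < #|F'|].
Proof.
move=> uF k0 ltF; pose up (Z : {set T}) := [set A in F | Z \subset A].
pose weight Z := #|up Z| * kappa ^ #|Z|.
have [Z _ maxZ] : exists2 Z, true & forall Y, weight Y <= weight Z.
  by case: (@arg_maxnP _ set0 predT weight) => // Z _ mZ; exists Z => // Y; apply: mZ.
have leF : #|F| <= weight Z.
  apply: leq_trans (maxZ set0); rewrite /weight cards0 muln1.
  by apply/subset_leq_card/subsetP => A AF; rewrite inE AF sub0set.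
exists Z => F'.
have cardF' : #|F'| = #|up Z|.
  apply: card_in_imset => A B; rewrite !inE => /andP[_ sA] /andP[_ sB] e.
  by rewrite -(setID A Z) -(setID B Z) e (setIidPr sA) (setIidPr sB).
split.
- move=> Y; have [dYZ|ndYZ] := boolP [disjoint Y & Z]; last first.
    rewrite (_ : [set A in F' | Y \subset A] = set0) ?cards0 //.
    apply/setP=> B; rewrite !inE; apply/negP=> /andP[/imsetP[A _ ->]].
    by rewrite subsetD (negPf ndYZ) andbF.
  have le_link : #|[set A in F' | Y \subset A]| <= #|up (Z :|: Y)|.
    apply: leq_trans (leq_imset_card (fun A => A :\: Z) _).
    apply/subset_leq_card/subsetP => B; rewrite inE => /andP[/imsetP[A + ->]].
    rewrite inE => /andP[AF sZ]; rewrite subsetD => /andP[sY _].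
    by apply/imsetP; exists A => //; rewrite inE AF subUset sZ.
  have := maxZ (Z :|: Y); rewrite /weight cardsU disjoint_setI0 1?disjoint_sym //.
  rewrite cards0 subn0 expnD cardF'.
  have p0 : 0 < kappa ^ #|Z| by rewrite expn_gt0 k0.
  rewrite mulnCA mulnC leq_pmul2r //; apply: leq_trans.
  by rewrite leq_mul2r le_link orbT.
- apply/imsetP=> -[A]; rewrite inE => /andP[AF sZ] /esym/eqP.
  rewrite setD_eq0 => sA; have eA : A = Z by apply/eqP; rewrite eqEsubset sA.
  move: leF; rewrite leqNgt => /negP; apply; apply: leq_ltn_trans ltF.
  rewrite /weight -{2}eA (uF A AF) -[leqRHS]mul1n leq_mul2r; apply/orP; right.
  rewrite -(cards1 Z); apply/subset_leq_card/subsetP => B; rewrite !inE => /andP[BF sB].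
  by rewrite eq_sym eqEcard sB (uF B BF) -eA (uF A AF) leqnn.
- rewrite cardF'; move: (leq_ltn_trans (leq0n _) ltF) => F0.
  by move: (leq_trans F0 leF); rewrite /weight muln_gt0 => /andP[].
Qed.

(** Otherwise [F] would have at most (w + 1) kappa^w members, and w + 1 <= 2^w. *)
Lemma large_layer (T : finType) (F : {set {set T}}) (kappa w : nat) :
  (forall A, A \in F -> #|A| <= w) -> 0 < kappa -> (2 * kappa) ^ w < #|F| ->
  exists2 k, k <= w & kappa ^ k < #|[set A in F | #|A| == k]|.
Proof.
move=> wF k0 ltF.
suff /existsP[k ltk] : [exists k : 'I_w.+1, kappa ^ k < #|[set A in F | #|A| == k]|].
  by exists k => //; rewrite -ltnS.
apply: contraLR ltF => /existsPn small; rewrite -leqNgt.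
have -> : #|F| = \sum_(k < w.+1) #|[set A in F | #|A| == k]|.
  rewrite -sum1_card (partition_big (fun A : {set T} => inord #|A| : 'I_w.+1) predT) //=.
  apply: eq_bigr => k _; rewrite -sum1dep_card; apply: eq_bigl => A.
  case AF: (A \in F) => //=; apply/eqP/eqP => [<-|->]; last by rewrite inord_val.
  by rewrite inordK // ltnS wF.
apply: (@leq_trans (\sum_(k < w.+1) kappa ^ w)).
  apply: leq_sum => k _; have := small k; rewrite -leqNgt => /leq_trans; apply.
  by rewrite leq_pexp2l // -ltnS.
by rewrite sum_nat_const card_ord expnMn leq_mul2r ltn_expl ?orbT.
Qed.

Lemma sunflower_of_link (T : finType) (F : {set {set T}}) (r : nat) (Z : {set T})
    (B : 'I_r -> {set T}) : 1 < r ->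
  (forall j, Z :|: B j \in F) -> (forall j, B j != set0) ->
  (forall j, [disjoint B j & Z]) -> (forall i j, i != j -> [disjoint B i & B j]) ->
  contains_sunflower r F.
Proof.
move=> r1 BF Bn0 BZ dB; pose petal j := Z :|: B j.
have meet i j : i != j -> petal i :&: petal j = Z.
  by move=> ij; rewrite -setUIr disjoint_setI0 ?setU0 // dB.
have petal_inj : injective petal.
  move=> i j e; apply/eqP; apply: contraTT (Bn0 i) => ij; rewrite negbK.
  have := meet i j ij; rewrite -e setIid => /setUidPl sBZ.
  by rewrite -(setIidPl sBZ) disjoint_setI0 ?BZ.
exists [set petal j | j : 'I_r]; first by apply/subsetP=> _ /imsetP[j _ ->]; apply: BF.
split=> [|_ _ /imsetP[i _ ->] /imsetP[j _ ->] ne].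
  by rewrite card_imset // card_ord.
have ij : i != j by apply: contraNneq ne => ->.
rewrite meet //; apply/eqP; rewrite eqEsubset; apply/andP; split.
  by apply/bigcapsP=> _ /imsetP[m _ ->]; apply: subsetUl.
rewrite -(meet i j ij) subsetI; apply/andP; split; apply: bigcap_inf; exact: imset_f.
Qed.

(** Here 2 kappa = 8 r^2 L for the spread kappa = 4 r (r L) that [r] groups of
    [L] colours require. *)
Theorem nat_sunflower_bound (T : finType) (F : {set {set T}}) (r L w : nat) :
  1 < r -> 0 < L -> w < 2 ^ L -> set_system_width w F ->
  (8 * r ^ 2 * L) ^ w < #|F| -> contains_sunflower r F.
Proof.
move=> r1 L0 ltw wF; pose kappa := 4 * r * (r * L).
rewrite (_ : 8 * r ^ 2 * L = 2 * kappa); last by rewrite /kappa; lia.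
have k0 : 0 < kappa by rewrite /kappa !muln_gt0 L0 (ltnW r1).
move/(large_layer wF k0) => [k lek]; set Fk := [set A in F | _] => ltFk.
have uFk A : A \in Fk -> #|A| = k by rewrite inE => /andP[_ /eqP].
have [Z [spF' F'0 F'n0]] := uniform_spread_link uFk k0 ltFk.
move: spF' F'0 F'n0; set F' := imset _ _ => spF' F'0 F'n0.
have linkP B : B \in F' -> [/\ Z :|: B \in F, [disjoint B & Z] & #|B| <= w].
  case/imsetP=> A; rewrite !inE => /andP[/andP[AF cA] sZA] ->; split.
  - by rewrite -[Z in Z :|: _](setIidPr sZA) setID.
  - by rewrite -setI_eq0 setIDAC setDIl setDv setI0.
  - by apply: leq_trans (subset_leq_card (subsetDl _ _)) (wF A AF).
have wF' A : A \in F' -> #|A| <= w by case/linkP.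
have [B BF' dB] := spread_disjoint_members r1 L0 ltw spF' wF' F'n0.
apply: (@sunflower_of_link _ _ _ Z B) => // [j|j|j].
- by case: (linkP _ (BF' j)).
- by apply: contraNneq F'0 => <-; apply: BF'.
- by case: (linkP _ (BF' j)).
Qed.

(** * Logarithms in base 1.9 *)

Local Open Scope ring_scope.

Lemma ln19_gt0 (R : realType) : (0 : R) < ln (19 / 10).
Proof. by apply: ln_gt0; lra. Qed.

Lemma log19_2_gt1 (R : realType) : (1 : R) < log19 (2 : R).
Proof.
rewrite /log19 ltr_pdivlMr ?ln19_gt0 // mul1r ltr_ln ?posrE //; lra.
Qed.

(** The integer part of the binary logarithm is at most log19 w and at
    least 1, so adding 1 at most doubles it. *)
Lemma trunc_log_le_log19 (R : realType) (w : nat) : (2 <= w)%N ->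
  ((trunc_log 2 w).+1%:R : R) <= 2 * log19 (w%:R : R).
Proof.
move=> w2; have p := ln19_gt0 R.
have le_l : (trunc_log 2 w)%:R <= log19 (w%:R : R).
  rewrite /log19 ler_pdivlMr // mulrC.
  have w0 : (0 < w)%N by lia.
  apply: (@le_trans _ _ (ln (2 ^+ trunc_log 2 w : R))).
    have b2 : ln (19 / 10 : R) <= ln 2 by rewrite ler_ln ?posrE //; lra.
    by rewrite lnXn // -[leRHS]mulr_natr ler_wpM2r ?ler0n.
  rewrite ler_ln ?posrE ?exprn_gt0 ?ltr0n // -natrX ler_nat.
  exact: trunc_logP.
have l1 : (1 : R) <= (trunc_log 2 w)%:R.
  by rewrite ler1n trunc_log_gt0 /=; lia.
rewrite -natr1; lra.
Qed.

Lemma log19_homo (R : realType) (x y : R) : 0 < x -> x <= y -> log19 x <= log19 y.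
Proof.
move=> x0 xy; have p := ln19_gt0 R.
rewrite /log19 ler_pM2r ?invr_gt0 // ler_ln ?posrE //; exact: lt_le_trans xy.
Qed.

Theorem theorem1p4 (R : realType) :
  exists C : R, 0 < C /\
    forall r w : nat, (3 <= r)%N -> (2 <= w)%N ->
    forall (T : finType) (F : {set {set T}}),
      set_system_width w F ->
      (C * r%:R ^+ 3 * log19 (w%:R : R) * log19 (log19 (w%:R : R))) ^+ w
        <= #|F|%:R ->
      contains_sunflower r F.
Proof.
have p := ln19_gt0 R.
have a1 := log19_2_gt1 R; set a := log19 2 in a1.
have b0 : 0 < log19 a by rewrite /log19 divr_gt0 // ln_gt0.
(* The denominator is the least value of log19 (log19 w); the 16 is the 8 of
   the combinatorial bound times the 2 lost in passing from L to log19 w. *)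
exists (16 / log19 a); split=> [|r w r3 w2 T F wF leF]; first by rewrite divr_gt0.
pose L := (trunc_log 2 w).+1.
apply: (@nat_sunflower_bound T F r L w) => //; first by lia.
  exact: trunc_log_ltn.
rewrite -(ltr_nat R) natrX; apply: lt_le_trans leF.
have leL := trunc_log_le_log19 R w2; rewrite -/L in leL.
set l := log19 w%:R in leL *.
have al : a <= l by rewrite log19_homo ?ltr0n // ler_nat.
have bl : log19 a <= log19 l by rewrite log19_homo //; lra.
have r3R : (3 : R) <= r%:R by rewrite ler_nat.
have L1 : (1 : R) <= L%:R by rewrite ler1n.
have main : (8 * r ^ 2 * L)%:R < 16 / log19 a * r%:R ^+ 3 * l * log19 l.
  have r0 : (0 : R) < r%:R ^+ 2 by apply: exprn_gt0; lra.
  apply: (@lt_le_trans _ _ (8 * r%:R ^+ 2 * L%:R * r%:R)).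
    rewrite 2!natrM natrX ltr_pMr; first by lra.
    by rewrite !mulr_gt0 //; lra.
  apply: (@le_trans _ _ (16 / log19 a * r%:R ^+ 3 * l * log19 a)).
    have -> : 16 / log19 a * r%:R ^+ 3 * l * log19 a = r%:R ^+ 3 * (16 * l).
      by field; rewrite gt_eqF.
    have -> : 8 * r%:R ^+ 2 * L%:R * r%:R = r%:R ^+ 3 * (8 * L%:R) :> R by ring.
    rewrite ler_pM2l; first by lra.
    by apply: exprn_gt0; lra.
  apply: ler_wpM2l bl; apply: mulr_ge0; last by lra.
  by rewrite mulr_ge0 ?exprn_ge0 // divr_ge0 // ltW.
by rewrite ltrXn2r ?ler0n //; case: (w) w2.
Qed.
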